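(* Let $g>0$, $d>0$ be fixed and consider smooth water waves that belong to the bifurcation curve $\mathcal C$ (for the given $g,d,\gamma$) in the adverse case $\gamma>0$. Let $m<0$, $Q>0$ be the mass flux and Bernoulli constant of the wave, let $\mathscr A=\eta(0)-\eta(\pi)$ be its amplitude, and put $N=\sup_x|\eta'(x)|$ (maximum slope) and $M=\sup_x|\eta''(x)|$ (convexity). (a) Assume that either the slope or the convexity is bounded. Then the amplitude is uniformly bounded by a certain constant provided $\gamma$ is sufficiently small, the upper bound depending only on $g,Q,m,d$. That is: for all $Q_0,m_0,K>0$ there exist $\gamma_0>0$ and a constant $B$ depending only on $g,Q_0,m_0,d$ such that every such wave with $0<\gamma<\gamma_0$, $Q\le Q_0$, $|m|\le m_0$ and ($N\le K$ or $M\le K$) satisfies $\mathscr A\le B$. (b) As an example, suppose that $$\gamma<\frac{gd}{|m|},\qquad \gamma^2<\frac{8dg^3}{Q^2},$$ and that either $$N\gamma^2<\frac{g\,\beta(\frac\pi2)}{8}\quad\text{and}\quad \gamma^2<\frac{1}{\frac12+\frac1d}\,\frac{g\,\beta(\frac\pi2)^2}{77\pi^2},$$ or $$\sqrt M\,\gamma^2<\frac{\pi g}{4}\left(\frac{\beta(\frac\pi2)}{12\pi}\right)^{3/2}\quad\text{and}\quad \gamma^2<\frac{2g}{\frac12+\frac1d}\left(\frac{\beta(\frac\pi2)}{12\pi}\right)^{2}.$$ Then $$\mathscr A<\frac{12\pi}{\beta(\frac\pi2)}<104 .$$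
   Context: **Steady waves.** Let $g>0$ (gravity), $\gamma\in\mathbb R$ (constant vorticity), $m<0$ (mass flux), $Q>0$ (Bernoulli constant). A $2\pi$-periodic steady wave is a fluid domain $\Omega$ in the $(X,Y)$-plane, $2\pi$-periodic in $X$, bounded below by $\mathcal B=\{Y=0\}$ and above by an unknown curve $\mathcal S$ lying strictly above $\mathcal B$, with a stream function $\Psi$ satisfying $\Delta\Psi=-\gamma$ in $\Omega$, $\Psi=0$ on $\mathcal S$, $\Psi=-m$ on $\mathcal B$, $|\nabla\Psi|^2+2gY=Q$ on $\mathcal S$. **Conformal formulation.** $\Omega$ is the image of the strip $\{-d<y<0\}$ under a conformal map $X+iY=\xi(x,y)+i\eta(x,y)$ (periodic up to the translation by $2\pi$ in $X$, mapping $y=-d$ to $\mathcal B$ and $y=0$ to $\mathcal S$); $d>0$ is the conformal depth. Write $\eta(x)=\eta(x,0)$, $\xi(x)=\xi(x,0)$, and $[\cdot]$ for the average over a period. The periodic Hilbert transform of the strip is $$\mathcal H\Big(\sum_{n\ge1}(a_n\cos nx+b_n\sin nx)\Big)=\sum_{n\ge1}\big(a_n\coth(nd)\sin nx-b_n\coth(nd)\cos nx\big)$$ on mean-zero $2\pi$-periodic $L^2$ functions; it is the principal-value convolution $\mathcal H F(x)=\frac1{2\pi}\,\mathrm{p.v.}\int_{-\pi}^{\pi}\beta(x-s)F(s)\,ds$ with kernel $$\beta(s)=-\frac sd+\frac\pi d\sum_{n=-\infty}^{\infty}\Big\{\coth\Big(\frac{\pi}{2d}(s-2\pi n)\Big)+\operatorname{sgn}(n)\Big\},\qquad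 s\in\mathbb R\setminus2\pi\mathbb Z$$ (with $\operatorname{sgn}(0)=0$), so $\beta$ depends on $d$. The wave problem is equivalent to $$\Big(\frac md+\frac{\gamma}{2d}[\eta^2]+\gamma\mathcal H(\eta\eta')-\gamma\eta\big(1+\mathcal H(\eta')\big)\Big)^2=(Q-2g\eta)\big((\eta')^2+(1+\mathcal H(\eta'))^2\big),$$ and equivalently to $$\mathcal H\big((Q-2g\eta-\gamma^2\eta^2)\eta'\big)+(Q-2g\eta-\gamma^2\eta^2)\mathcal H(\eta')+2\gamma^2\eta\mathcal H(\eta\eta')=\eta\Big(-\tfrac{2m\gamma}{d}-\tfrac{\gamma^2}{d}[\eta^2]+2g\Big)+\gamma^2\eta^2+2\gamma m-2gd-2g[\eta\mathcal H(\eta')]$$ together with equality of the averages of the two sides of the preceding equation. **The curve $\mathcal C$.** For fixed $g,d,\gamma$, $\mathcal C$ is the continuous curve $s\mapsto(\Psi(s),m(s),Q(s))$, $0\le s<\infty$, of solutions constructed by global bifurcation by Constantin, Strauss and Varvaruca. It begins at the laminar flow ($\eta\equiv d$), and all its waves satisfy: $m<0$, $Q>0$; $\eta\in C^{2,\alpha}(\mathbb R)$ for some $\alpha\in(0,1)$, $\eta$ is $2\pi$-periodic and even, $[\eta]=d$; $x\mapsto(\xi(x),\eta(x))$ is injective on $\mathbb R$; $\inf_x (Q-2g\eta)^2|\nabla\eta|^2>0$ on $y=0$, with $Q-2g\eta>0$; the nonlaminar waves have $\eta'<0$ on $(0,\pi)$ and $\eta'>0$ on $(-\pi,0)$ (crest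 at $x=0$, trough at $x=\pi$). The curve ends with one of: the $C^{2,\alpha}$ norm is unbounded; $|m(s)|+Q(s)\to\infty$; $\min_x\{Q(s)-2g\eta_s(x)\}\to0$; or the profile self-intersects strictly above the trough at some finite $s^*$. *)

(* Defs.v *)
From Stdlib Require Import Reals ZArith.
From Coquelicot Require Import Coquelicot.

Open Scope R_scope.

(** * The kernel and the Hilbert transform of the strip *)

Definition coth (x : R) : R := cosh x / sinh x.

Definition series_Z (a : Z -> R) : R :=
  a 0%Z + Series (fun k => a (Z.of_nat (S k)))
        + Series (fun k => a (- Z.of_nat (S k))%Z).

Definition beta (d s : R) : R :=
  - s / d + PI / d *
    series_Z (fun n => coth (PI / (2 * d) * (s - 2 * PI * IZR n)) + IZR (Z.sgn n)).

(** Principal-value convolution with [beta d].  The period of integration is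
    centred at the singularity [s = x], which by periodicity of the integrand
    is the same as integrating over [-PI, PI].  [Lim] is a two-sided limit,
    hence [Rabs e]. *)
Definition hilbert (d : R) (F : R -> R) (x : R) : R :=
  / (2 * PI) *
  real (Lim (fun e =>
          RInt (fun s => beta d (x - s) * F s) (x - PI) (x - Rabs e) +
          RInt (fun s => beta d (x - s) * F s) (x + Rabs e) (x + PI)) 0).

Definition average (f : R -> R) : R := RInt f (- PI) PI / (2 * PI).

(** * Supremum and Hölder norms *)

Definition sup_abs (f : R -> R) : Rbar :=
  Lub_Rbar (fun y => exists x, y = Rabs (f x)).

Definition holder_seminorm (alpha : R) (f : R -> R) : Rbar :=
  Lub_Rbar (fun y => exists x1 x2, x1 <> x2 /\
    y = Rabs (f x1 - f x2) / Rpower (Rabs (x1 - x2)) alpha).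

Definition holder2_norm (alpha : R) (f : R -> R) : Rbar :=
  Rbar_plus (Rbar_plus (sup_abs f) (sup_abs (Derive f)))
            (Rbar_plus (sup_abs (Derive_n f 2))
                       (holder_seminorm alpha (Derive_n f 2))).

Definition class_C2alpha (alpha : R) (f : R -> R) : Prop :=
  (forall x, ex_derive f x) /\ (forall x, ex_derive (Derive f) x) /\
  Rbar_lt (holder2_norm alpha f) p_infty.

(** * Waves *)

(** [(conf_xi, conf_eta)] parametrizes the fluid domain by the strip
    [-d < y < 0]; [stream] is the stream function in the physical variables
    [(X, Y)]; [mass_flux] is m and [bernoulli] is Q.  The depth [d] is a
    parameter of the predicates below. *)
Record wave : Type := mkWave {
  conf_xi : R -> R -> R;
  conf_eta : R -> R -> R;
  stream : R -> R -> R;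
  mass_flux : R;
  bernoulli : R
}.

Definition xi (w : wave) (x : R) : R := conf_xi w x 0.
Definition eta (w : wave) (x : R) : R := conf_eta w x 0.

Definition amplitude (w : wave) : R := eta w 0 - eta w PI.

(** The waves considered have bounded [eta'] and [eta''], so the suprema are
    finite and [real] loses nothing. *)
Definition max_slope (w : wave) : R := real (sup_abs (Derive (eta w))).
Definition convexity (w : wave) : R := real (sup_abs (Derive_n (eta w) 2)).

Definition uncurry2 (f : R -> R -> R) (p : R * R) : R := f (fst p) (snd p).

(** [conf_xi + i conf_eta] is holomorphic in the open strip (Cauchy-Riemann),
    continuous up to its boundary, periodic up to the translation by 2 PI, and
    sends [y = -d] to the bed. *)
Definition strip_map (d : R) (w : wave) : Prop :=
  continuous_on (fun p : R * R => - d <= snd p <= 0) (uncurry2 (conf_xi w)) /\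
  continuous_on (fun p : R * R => - d <= snd p <= 0) (uncurry2 (conf_eta w)) /\
  (forall x y, - d < y < 0 -> exists a b,
     differentiable_pt_lim (conf_xi w) x y a (- b) /\
     differentiable_pt_lim (conf_eta w) x y b a) /\
  (forall x y, - d <= y <= 0 ->
     conf_xi w (x + 2 * PI) y = conf_xi w x y + 2 * PI /\
     conf_eta w (x + 2 * PI) y = conf_eta w x y) /\
  (forall x, conf_eta w x (- d) = 0).

Definition fluid_domain (d : R) (w : wave) (p : R * R) : Prop :=
  exists x y, - d < y < 0 /\ p = (conf_xi w x y, conf_eta w x y).

Definition fluid_closure (d : R) (w : wave) (p : R * R) : Prop :=
  exists x y, - d <= y <= 0 /\ p = (conf_xi w x y, conf_eta w x y).

(** The free-boundary problem.  [Psi1, Psi2] are the components of the gradient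
    of [stream], extended continuously up to the boundary. *)
Definition steady_wave (g gamma d : R) (w : wave) : Prop :=
  strip_map d w /\
  (forall x1 y1 x2 y2, - d < y1 < 0 -> - d < y2 < 0 ->
     conf_xi w x1 y1 = conf_xi w x2 y2 ->
     conf_eta w x1 y1 = conf_eta w x2 y2 -> x1 = x2 /\ y1 = y2) /\
  (forall x, 0 < eta w x) /\
  (forall X Y, fluid_closure d w (X, Y) ->
     stream w (X + 2 * PI) Y = stream w X Y) /\
  exists Psi1 Psi2 : R -> R -> R,
    continuous_on (fluid_closure d w) (uncurry2 (stream w)) /\
    continuous_on (fluid_closure d w) (uncurry2 Psi1) /\
    continuous_on (fluid_closure d w) (uncurry2 Psi2) /\
    (forall X Y, fluid_domain d w (X, Y) ->
       differentiable_pt_lim (stream w) X Y (Psi1 X Y) (Psi2 X Y) /\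
       exists p11 p12 p21 p22,
         differentiable_pt_lim Psi1 X Y p11 p12 /\
         differentiable_pt_lim Psi2 X Y p21 p22 /\
         p11 + p22 = - gamma) /\
    (forall x, stream w (xi w x) (eta w x) = 0) /\
    (forall X, stream w X 0 = - mass_flux w) /\
    (forall x, Psi1 (xi w x) (eta w x) ^ 2 + Psi2 (xi w x) (eta w x) ^ 2
               + 2 * g * eta w x = bernoulli w).

(** * The conformal formulation *)

Definition bernoulli_lhs (gamma d : R) (w : wave) (x : R) : R :=
  let h := eta w in
  (mass_flux w / d + gamma / (2 * d) * average (fun z => h z ^ 2)
   + gamma * hilbert d (fun z => h z * Derive h z) x
   - gamma * h x * (1 + hilbert d (Derive h) x)) ^ 2.

Definition bernoulli_rhs (g d : R) (w : wave) (x : R) : R :=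
  let h := eta w in
  (bernoulli w - 2 * g * h x)
  * (Derive h x ^ 2 + (1 + hilbert d (Derive h) x) ^ 2).

Definition bernoulli_equation (g gamma d : R) (w : wave) : Prop :=
  forall x, bernoulli_lhs gamma d w x = bernoulli_rhs g d w x.

Definition quasilinear_equation (g gamma d : R) (w : wave) : Prop :=
  let h := eta w in
  let m := mass_flux w in
  let Q := bernoulli w in
  let P := fun z => Q - 2 * g * h z - gamma ^ 2 * h z ^ 2 in
  forall x,
    hilbert d (fun z => P z * Derive h z) x
    + P x * hilbert d (Derive h) x
    + 2 * gamma ^ 2 * h x * hilbert d (fun z => h z * Derive h z) x
    = h x * (- (2 * m * gamma / d)
             - gamma ^ 2 / d * average (fun z => h z ^ 2) + 2 * g)
      + gamma ^ 2 * h x ^ 2 + 2 * gamma * m - 2 * g * d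
      - 2 * g * average (fun z => h z * hilbert d (Derive h) z).

Definition mean_equation (g gamma d : R) (w : wave) : Prop :=
  average (bernoulli_lhs gamma d w) = average (bernoulli_rhs g d w).

(** The two formulations are equivalent to each other and to the free-boundary
    problem; all of them are recorded. *)
Definition conformal_solution (g gamma d : R) (w : wave) : Prop :=
  bernoulli_equation g gamma d w /\
  quasilinear_equation g gamma d w /\
  mean_equation g gamma d w.

(** * The bifurcation curve *)

Definition laminar (d : R) (w : wave) : Prop := forall x, eta w x = d.

(** Properties of the individual waves.  By Cauchy-Riemann,
    [|grad eta|^2 = xi'^2 + eta'^2] on [y = 0]. *)
Definition regular_wave (alpha g gamma d : R) (w : wave) : Prop :=
  steady_wave g gamma d w /\
  conformal_solution g gamma d w /\
  mass_flux w < 0 /\ 0 < bernoulli w /\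
  class_C2alpha alpha (eta w) /\
  (forall x, eta w (x + 2 * PI) = eta w x) /\
  (forall x, eta w (- x) = eta w x) /\
  average (eta w) = d /\
  (forall x1 x2, xi w x1 = xi w x2 -> eta w x1 = eta w x2 -> x1 = x2) /\
  (exists c, 0 < c /\ forall x,
     c <= (bernoulli w - 2 * g * eta w x) ^ 2
          * (Derive (xi w) x ^ 2 + Derive (eta w) x ^ 2)) /\
  (forall x, 0 < bernoulli w - 2 * g * eta w x) /\
  (~ laminar d w ->
     (forall x, 0 < x < PI -> Derive (eta w) x < 0) /\
     (forall x, - PI < x < 0 -> 0 < Derive (eta w) x)).

(** [curve_end] is the parameter at which the profile first self-intersects
    ([p_infty] if it never does); the waves of the curve are those with
    parameter [0 <= s < curve_end]. *)
Record curve : Type := mkCurve {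
  curve_at : R -> wave;
  curve_end : Rbar
}.

Definition belongs_to (w : wave) (C : curve) : Prop :=
  exists s, 0 <= s /\ Rbar_lt s (curve_end C) /\ w = curve_at C s.

(** Continuity of the surface profile, the mass flux and the Bernoulli constant;
    the profile and the mass flux determine the fluid domain (up to a horizontal
    translation) and the stream function. *)
Definition continuous_curve (alpha : R) (C : curve) : Prop :=
  forall s, 0 <= s -> Rbar_le s (curve_end C) ->
  forall eps, 0 < eps -> exists delta, 0 < delta /\
  forall t, 0 <= t -> Rbar_le t (curve_end C) -> Rabs (t - s) < delta ->
    Rbar_lt (holder2_norm alpha
               (fun x => eta (curve_at C t) x - eta (curve_at C s) x)) eps /\
    Rabs (mass_flux (curve_at C t) - mass_flux (curve_at C s)) < eps /\
    Rabs (bernoulli (curve_at C t) - bernoulli (curve_at C s)) < eps.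

Definition unbounded_norm (alpha : R) (C : curve) : Prop :=
  forall K : R, exists s, 0 <= s /\ Rbar_lt s (curve_end C) /\
    Rbar_lt K (holder2_norm alpha (eta (curve_at C s))).

Definition unbounded_parameters (C : curve) : Prop :=
  is_lim (fun s => Rabs (mass_flux (curve_at C s)) + bernoulli (curve_at C s))
         p_infty p_infty.

Definition approaches_stagnation (g : R) (C : curve) : Prop :=
  is_lim (fun s =>
            real (Glb_Rbar (fun y => exists x,
              y = bernoulli (curve_at C s) - 2 * g * eta (curve_at C s) x)))
         p_infty 0.

Definition self_intersects_above_trough (w : wave) : Prop :=
  exists x1 x2, x1 <> x2 /\ xi w x1 = xi w x2 /\ eta w x1 = eta w x2 /\
    eta w PI < eta w x1.

Definition bifurcation_curve (g gamma d : R) (C : curve) : Prop :=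
  Rbar_lt 0 (curve_end C) /\
  exists alpha, 0 < alpha < 1 /\
    continuous_curve alpha C /\
    laminar d (curve_at C 0) /\
    (forall w, belongs_to w C -> regular_wave alpha g gamma d w) /\
    ((curve_end C = p_infty /\
      (unbounded_norm alpha C \/ unbounded_parameters C \/
       approaches_stagnation g C)) \/
     (exists s, curve_end C = Finite s /\ strip_map d (curve_at C s) /\
        self_intersects_above_trough (curve_at C s))).

(* Main.v *)
(** Subtract the quasilinear equation at the trough [x = PI] from the one at the
    crest [x = 0].  At a point [x] about which [eta] is even, the three Hilbert
    transforms combine into a single integral over [(0, PI)] of [beta] against
    [(2 (Q - 2 g eta(x)) + 2 g u - gamma^2 u^2) u'] with [u = eta(x) - eta(x +- t)].
    Both integrands are nonnegative because [gamma^2 A <= 2 g], and [beta] decreases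
    from [+oo] at [0] to [0] at [PI]; bounding [beta] below by [b = beta(PI/2)] on
    [(0, PI/2)] and by [0] on [(PI/2, PI)] leaves exact derivatives, so that
    [(b / PI) (g A^2 - gamma^2 A^3 / 3)] is at most
    [A (2 gamma |m| / d + 2 g - gamma^2 [eta^2] / d) + gamma^2 (eta(0)^2 - eta(PI)^2)].
    Since [d <= eta(0) < Q / (2 g)], the bound on [gamma^2 Q^2] gives
    [gamma^2 eta(0)^2 < 2 d g]; with [[eta^2] >= d^2] and [gamma |m| < g d],
    [A b >= 12 PI] would force [(eta(0) - d) (4 eta(0) - d) < 0].

    For the numerical bound, [b] is at least [(y + 2 y / sinh y) / PI] with
    [y = PI^2 / (2 d)]. *)

Require Import Defs.
From Stdlib Require Import Reals Lra Psatz Classical.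
From Coquelicot Require Import Coquelicot.
Open Scope R_scope.

(** * The kernel *)

Lemma coth_opp (x : R) : coth (- x) = - coth x.
Proof.
  unfold coth, cosh, sinh. rewrite Ropp_involutive.
  replace (exp (- x) - exp x) with (- (exp x - exp (- x))) by ring.
  rewrite (Rplus_comm (exp (- x))). unfold Rdiv. rewrite !Rinv_mult, Rinv_opp. ring.
Qed.

Lemma exp_neq_1 (x : R) : x <> 0 -> exp x <> 1.
Proof. intros Hx E. apply Hx, exp_inv. now rewrite exp_0. Qed.

(** In this form [coth x - 1] is [2 q / (1 - q)] with [q = exp (- (2 * x))], the shape of a Lambert
    term. *)
Lemma coth_exp (x : R) : x <> 0 ->
  coth x = 1 + 2 * exp (- (2 * x)) / (1 - exp (- (2 * x))).
Proof.
  intros Hx.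
  assert (Hn : exp (- (2 * x)) <> 1) by (apply exp_neq_1; lra).
  assert (Hp := exp_pos x).
  replace (exp (- (2 * x))) with (/ exp x * / exp x) in *
    by (rewrite <- !exp_Ropp, <- exp_plus; f_equal; ring).
  assert (Hn2 : exp x * exp x <> 1).
  { intros E. apply Hn. rewrite <- Rinv_mult, E. apply Rinv_1. }
  unfold coth, cosh, sinh. rewrite exp_Ropp. field. repeat split; lra.
Qed.

(** In the variable [v = exp (+- PI s / d)] the terms [n <> 0] of [beta] form
    two copies of the following Lambert series with [r = exp (- 2 PI^2 / d)]. *)
Definition lambert_term (r v : R) (k : nat) : R :=
  2 * (r ^ S k * v) / (1 - r ^ S k * v).

Definition lambert (r v : R) : R := Series (lambert_term r v).

Lemma pow_S_le (r : R) (k : nat) : 0 < r < 1 -> 0 < r ^ S k <= r.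
Proof.
  intros Hr. split; [apply pow_lt; lra|].
  assert (H1 : r ^ k <= 1) by (rewrite <- (pow1 k); apply pow_incr; lra).
  assert (H2 : 0 < r ^ k) by (apply pow_lt; lra).
  simpl. nra.
Qed.

(** The difference is [2 q (v - u) / ((1 - q v) (1 - q u))] with [q = r ^ S k]; both factors below
    are at least [1 - r v] because [q <= r] and [u <= v]. *)
Lemma lambert_term_diff (r u v : R) (k : nat) :
  0 < r < 1 -> 0 < u -> u <= v -> r * v < 1 ->
  0 <= lambert_term r v k - lambert_term r u k
    <= 2 * r ^ S k / (1 - r * v) ^ 2 * (v - u).
Proof.
  intros Hr Hu Huv Hv.
  destruct (pow_S_le r k Hr) as [Hq0 Hq1].
  unfold lambert_term. set (q := r ^ S k) in *.
  assert (q * v <= r * v) by nra. assert (q * u <= q * v) by nra.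
  replace (2 * (q * v) / (1 - q * v) - 2 * (q * u) / (1 - q * u))
    with (2 * q * (v - u) * / ((1 - q * v) * (1 - q * u))) by (field; lra).
  replace (2 * q / (1 - r * v) ^ 2 * (v - u))
    with (2 * q * (v - u) * / (1 - r * v) ^ 2) by (field; lra).
  assert (H2 : 0 <= 2 * q * (v - u)) by nra.
  split.
  - apply Rmult_le_pos; [lra|]. left. apply Rinv_0_lt_compat. nra.
  - apply Rmult_le_compat_l; [lra|]. apply Rinv_le_contravar; nra.
Qed.

Lemma ex_series_pow_S (r c : R) : 0 < r < 1 -> ex_series (fun k => c * r ^ S k).
Proof.
  intros Hr. apply ex_series_ext with (fun k => scal (c * r) (r ^ k)).
  - intros k. unfold scal; simpl; unfold mult; simpl. ring.
  - apply (ex_series_scal (V := R_NormedModule) (c * r) (pow r)), ex_series_geom. rewrite Rabs_right; lra.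
Qed.

Lemma ex_series_lambert (r v : R) :
  0 < r < 1 -> 0 < v -> r * v < 1 -> ex_series (lambert_term r v).
Proof.
  intros Hr Hv Hrv.
  apply (ex_series_le (V := R_CompleteNormedModule)) with (fun k => 2 * v / (1 - r * v) * r ^ S k);
    [|now apply ex_series_pow_S].
  intros k. destruct (pow_S_le r k Hr) as [Hq0 Hq1].
  unfold lambert_term. set (q := r ^ S k) in *.
  assert (q * v <= r * v) by nra. assert (0 < q * v) by nra.
  change (norm (2 * (q * v) / (1 - q * v))) with (Rabs (2 * (q * v) / (1 - q * v))).
  rewrite Rabs_right.
  - replace (2 * v / (1 - r * v) * q) with (2 * (q * v) * / (1 - r * v)) by (field; lra).
    apply Rmult_le_compat_l; [lra|]. apply Rinv_le_contravar; lra.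
  - apply Rle_ge, Rmult_le_pos; [lra|]. left. apply Rinv_0_lt_compat. lra.
Qed.

(** Summed termwise. The lower bound serves the monotonicity of the kernel, the upper bound gives a
    Lipschitz constant. *)
Lemma lambert_diff (r u v : R) :
  0 < r < 1 -> 0 < u -> u <= v -> r * v < 1 ->
  0 <= lambert r v - lambert r u
    <= Series (fun k => 2 / (1 - r * v) ^ 2 * r ^ S k) * (v - u).
Proof.
  intros Hr Hu Huv Hv.
  assert (r * u < 1) by nra.
  unfold lambert. rewrite <- Series_minus by (apply ex_series_lambert; lra).
  rewrite <- Series_scal_r.
  assert (Hk : forall k,
    0 <= lambert_term r v k - lambert_term r u k
      <= 2 / (1 - r * v) ^ 2 * r ^ S k * (v - u)).
  { intros k. destruct (lambert_term_diff r u v k Hr Hu Huv Hv) as [H1 H2].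
    split; [exact H1|]. eapply Rle_trans; [exact H2|]. right. field. lra. }
  split.
  - rewrite <- (Rmult_0_l (Series (fun _ => 0))), <- Series_scal_l.
    apply Series_le; [intros k; rewrite Rmult_0_l; split; [lra|apply Hk]|].
    apply (ex_series_minus (lambert_term r v) (lambert_term r u));
      apply ex_series_lambert; lra.
  - apply Series_le; [exact Hk|].
    apply ex_series_ext with (fun k => 2 / (1 - r * v) ^ 2 * (v - u) * r ^ S k).
    + intros k. simpl. field. lra.
    + now apply ex_series_pow_S.
Qed.

Lemma continuous_lambert (r v : R) :
  0 < r < 1 -> 0 < v -> r * v < 1 -> continuous (lambert r) v.
Proof.
  intros Hr Hv Hrv.
  (* The midpoint between [v] and the singularity [/ r]; on [(0, V]] one Lipschitz constant [L]
     serves all pairs. *)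
  set (V := (v + / r) / 2).
  assert (HvV : v < V).
  { unfold V. assert (v < / r); [|lra].
    apply (Rmult_lt_reg_l r); [lra|]. rewrite Rinv_r; lra. }
  assert (HV : r * V < 1).
  { unfold V. replace (r * ((v + / r) / 2)) with ((r * v + 1) / 2) by (field; lra). lra. }
  set (L := Series (fun k => 2 / (1 - r * V) ^ 2 * r ^ S k)).
  assert (HL : forall a b, 0 < a -> a <= b -> b <= V ->
            0 <= lambert r b - lambert r a <= L * (b - a)).
  { intros a b Ha Hab HbV.
    assert (r * b <= r * V) by nra.
    destruct (lambert_diff r a b Hr Ha Hab) as [H1 H2]; [lra|].
    split; [exact H1|]. eapply Rle_trans; [exact H2|].
    apply Rmult_le_compat_r; [lra|]. unfold L. apply Series_le.
    - intros k. destruct (pow_S_le r k Hr).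
      assert (0 < / (1 - r * b) ^ 2) by (apply Rinv_0_lt_compat; nra).
      assert (/ (1 - r * b) ^ 2 <= / (1 - r * V) ^ 2) by (apply Rinv_le_contravar; nra).
      unfold Rdiv. split.
      + apply Rmult_le_pos; lra.
      + apply Rmult_le_compat_r; lra.
    - now apply ex_series_pow_S. }
  assert (HL0 : 0 <= L).
  { destruct (HL v V) as [H1 H2]; try lra. nra. }
  apply continuity_pt_filterlim. intros eps Heps.
  (* The first two radii keep [x] inside [(0, V)]; dividing by [L + 1] also covers [L = 0]. *)
  exists (Rmin (Rmin v (V - v)) (eps / (L + 1))). split.
  { apply Rmin_pos; [apply Rmin_pos; lra|]. apply Rdiv_lt_0_compat; lra. }
  intros x [_ Hx]. simpl in *. unfold R_dist in *.
  assert (H1 : Rabs (x - v) < v) by (eapply Rlt_le_trans; [exact Hx|];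
    eapply Rle_trans; [apply Rmin_l|]; apply Rmin_l).
  assert (H2 : Rabs (x - v) < V - v) by (eapply Rlt_le_trans; [exact Hx|];
    eapply Rle_trans; [apply Rmin_l|]; apply Rmin_r).
  assert (H3 : Rabs (x - v) < eps / (L + 1)) by (eapply Rlt_le_trans; [exact Hx|]; apply Rmin_r).
  assert (H4 : (L + 1) * Rabs (x - v) < eps).
  { apply (Rmult_lt_compat_l (L + 1)) in H3; [|lra].
    replace ((L + 1) * (eps / (L + 1))) with eps in H3 by (field; lra). exact H3. }
  assert (H5 := Rabs_pos (x - v)).
  apply Rle_lt_trans with (L * Rabs (x - v)); [|nra].
  destruct (Rle_dec x v).
  - rewrite (Rabs_left1 (x - v)) in * by lra.
    destruct (HL x v) as [H6 H7]; try lra.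
    rewrite Rabs_left1; lra.
  - rewrite (Rabs_right (x - v)) in * by lra.
    destruct (HL v x) as [H6 H7]; try lra.
    rewrite Rabs_right; lra.
Qed.

(** What remains of the kernel once the term [n = 0], which carries the pole at [0], is removed. *)
Definition beta_regular (d s : R) : R :=
  - s / d + PI / d * (lambert (exp (- (2 * PI ^ 2 / d))) (exp (- (PI / d * s)))
                      - lambert (exp (- (2 * PI ^ 2 / d))) (exp (PI / d * s))).

Lemma exp_lt_1 (x : R) : x < 0 -> 0 < exp x < 1.
Proof. intros Hx. split; [apply exp_pos|]. rewrite <- exp_0. now apply exp_increasing. Qed.

Lemma nome_bounds (d : R) : 0 < d -> 0 < exp (- (2 * PI ^ 2 / d)) < 1.
Proof.
  intros Hd. apply exp_lt_1.
  assert (0 < 2 * PI ^ 2 / d) by (apply Rdiv_lt_0_compat; [|lra]; assert (H := PI_RGT_0); nra).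
  lra.
Qed.

(** The product is [exp (PI / d * (s - 2 * PI))]: the first pole of the Lambert series is the pole
    of the kernel at [2 * PI]. *)
Lemma nome_mul_exp (d s : R) : 0 < d -> s < 2 * PI ->
  exp (- (2 * PI ^ 2 / d)) * exp (PI / d * s) < 1.
Proof.
  intros Hd Hs. rewrite <- exp_plus. apply exp_lt_1.
  assert (H := PI_RGT_0).
  replace (- (2 * PI ^ 2 / d) + PI / d * s) with (PI / d * (s - 2 * PI)) by (field; lra).
  assert (0 < PI / d) by (apply Rdiv_lt_0_compat; lra). nra.
Qed.

Lemma nome_mul_exp_opp (d s : R) : 0 < d -> - (2 * PI) < s ->
  exp (- (2 * PI ^ 2 / d)) * exp (- (PI / d * s)) < 1.
Proof.
  intros Hd Hs. replace (- (PI / d * s)) with (PI / d * (- s)) by ring.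
  apply nome_mul_exp; lra.
Qed.

Lemma exp_INR_mult (x : R) (n : nat) : exp (x * INR n) = exp x ^ n.
Proof.
  induction n as [|n IH].
  - simpl. now rewrite Rmult_0_r, exp_0.
  - rewrite S_INR, Rmult_plus_distr_l, Rmult_1_r, exp_plus, IH. simpl. ring.
Qed.

Lemma coth_nome (d s : R) (n : nat) : 0 < d -> s < 2 * PI ->
  coth (PI / (2 * d) * (2 * PI * INR (S n) - s)) - 1
  = lambert_term (exp (- (2 * PI ^ 2 / d))) (exp (PI / d * s)) n.
Proof.
  intros Hd Hs. assert (HP := PI_RGT_0).
  assert (Hn : 1 <= INR (S n)) by (rewrite S_INR; assert (H := pos_INR n); lra).
  assert (0 < PI / (2 * d)) by (apply Rdiv_lt_0_compat; lra).
  rewrite coth_exp.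
  - unfold lambert_term.
    replace (exp (- (2 * (PI / (2 * d) * (2 * PI * INR (S n) - s)))))
      with (exp (- (2 * PI ^ 2 / d)) ^ S n * exp (PI / d * s)).
    + ring.
    + rewrite <- exp_INR_mult, <- exp_plus. f_equal. field. lra.
  - assert (0 < 2 * PI * INR (S n) - s) by nra. nra.
Qed.

(** Since [sgn n] cancels the limit of [coth], the terms [n > 0] form minus the Lambert series at
    [exp (PI / d * s)], and the terms [n < 0] the one at [exp (- (PI / d * s))]. *)
Lemma beta_eq (d s : R) : 0 < d -> - (2 * PI) < s < 2 * PI ->
  beta d s = PI / d * coth (PI / (2 * d) * s) + beta_regular d s.
Proof.
  intros Hd Hs. assert (HP := PI_RGT_0).
  unfold beta, beta_regular, series_Z, lambert.
  rewrite (Series_ext (fun k => coth (PI / (2 * d) * (s - 2 * PI * IZR (Z.of_nat (S k))))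
                                + IZR (Z.sgn (Z.of_nat (S k))))
             (fun k => - lambert_term (exp (- (2 * PI ^ 2 / d))) (exp (PI / d * s)) k)).
  2:{ intros k. rewrite <- coth_nome by lra. rewrite <- INR_IZR_INZ.
      replace (PI / (2 * d) * (s - 2 * PI * INR (S k)))
        with (- (PI / (2 * d) * (2 * PI * INR (S k) - s))) by ring.
      rewrite coth_opp. change (IZR (Z.sgn (Z.of_nat (S k)))) with 1. ring. }
  rewrite (Series_ext (fun k => coth (PI / (2 * d) * (s - 2 * PI * IZR (- Z.of_nat (S k))))
                                + IZR (Z.sgn (- Z.of_nat (S k))))
             (lambert_term (exp (- (2 * PI ^ 2 / d))) (exp (- (PI / d * s))))).
  2:{ intros k. replace (- (PI / d * s)) with (PI / d * - s) by ring.
      rewrite <- coth_nome by lra. rewrite opp_IZR, <- INR_IZR_INZ.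
      replace (s - 2 * PI * - INR (S k)) with (2 * PI * INR (S k) - - s) by ring.
      change (IZR (Z.sgn (- Z.of_nat (S k)))) with (-1). ring. }
  rewrite Series_opp. simpl (IZR (Z.sgn 0)).
  replace (s - 2 * PI * 0) with s by ring. ring.
Qed.

Lemma beta_opp (d s : R) : 0 < d -> - (2 * PI) < s < 2 * PI ->
  beta d (- s) = - beta d s.
Proof.
  intros Hd Hs. rewrite !beta_eq by lra. unfold beta_regular.
  rewrite !Ropp_mult_distr_r_reverse, coth_opp, !Ropp_involutive.
  unfold Rdiv. ring.
Qed.

Lemma continuous_beta_regular (d s : R) : 0 < d -> - (2 * PI) < s < 2 * PI ->
  continuous (beta_regular d) s.
Proof.
  intros Hd Hs.
  assert (Hl : forall v, continuous v s -> 0 < v s ->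
    exp (- (2 * PI ^ 2 / d)) * v s < 1 ->
    continuous (fun x => lambert (exp (- (2 * PI ^ 2 / d))) (v x)) s).
  { intros v Hv H0 H1. apply (continuous_comp v (lambert _)); [exact Hv|].
    apply continuous_lambert; [now apply nome_bounds|exact H0|exact H1]. }
  assert (He : forall c, continuous (fun x => exp (c * x)) s).
  { intros c. apply (ex_derive_continuous (V := R_NormedModule)). auto_derive. exact I. }
  unfold beta_regular.
  apply (continuous_plus (V := R_NormedModule)).
  - apply (ex_derive_continuous (V := R_NormedModule)). auto_derive. lra.
  - apply (continuous_scal_r (V := R_NormedModule)).
    apply (continuous_minus (V := R_NormedModule)).
    + apply (Hl (fun x => exp (- (PI / d * x)))); [|apply exp_pos|apply nome_mul_exp_opp; lra].
      apply (continuous_ext (fun x => exp (- (PI / d) * x))); [|apply He].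
      intros x. f_equal. ring.
    + apply (Hl (fun x => exp (PI / d * x))); [apply He|apply exp_pos|apply nome_mul_exp; lra].
Qed.

(** * Monotonicity and sign of the kernel on a half period *)

Lemma coth_diff (x y : R) : 0 < x -> 0 < y ->
  coth x - coth y = sinh (y - x) / (sinh x * sinh y).
Proof.
  intros Hx Hy.
  assert (Hsx : 0 < sinh x) by now rewrite <- sinh_0; apply sinh_lt.
  assert (Hsy : 0 < sinh y) by now rewrite <- sinh_0; apply sinh_lt.
  replace (sinh (y - x)) with (cosh x * sinh y - cosh y * sinh x).
  - unfold coth. field. lra.
  - unfold cosh, sinh, Rminus.
    rewrite Ropp_plus_distr, Ropp_involutive, !exp_plus. field.
Qed.

(** Both Lambert contributions to [beta] decrease in [s], so dropping them leaves the pole term and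
    the linear term. This serves the monotonicity and the numerical bound alike. *)
Lemma beta_diff_ge (d s t : R) : 0 < d -> 0 < s -> s <= t -> t < 2 * PI ->
  PI / d * (coth (PI / (2 * d) * s) - coth (PI / (2 * d) * t)) + (t - s) / d
  <= beta d s - beta d t.
Proof.
  intros Hd Hs Hst Ht. assert (HP := PI_RGT_0).
  assert (HPd : 0 < PI / d) by (apply Rdiv_lt_0_compat; lra).
  assert (He : forall a b, a <= b -> exp a <= exp b)
    by (intros a b [H| ->]; [left; now apply exp_increasing|right; reflexivity]).
  assert (Hr := nome_bounds d Hd).
  rewrite !beta_eq by lra. unfold beta_regular.
  set (r := exp (- (2 * PI ^ 2 / d))) in *.
  assert (H1 : 0 <= lambert r (exp (PI / d * t)) - lambert r (exp (PI / d * s))).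
  { apply lambert_diff; [exact Hr|apply exp_pos|apply He; nra|now apply nome_mul_exp]. }
  assert (H2 : 0 <= lambert r (exp (- (PI / d * s))) - lambert r (exp (- (PI / d * t)))).
  { apply lambert_diff; [exact Hr|apply exp_pos|apply He; nra|apply nome_mul_exp_opp; lra]. }
  replace ((t - s) / d) with (- s / d - - t / d) by (field; lra).
  nra.
Qed.

Lemma sinh_pos (x : R) : 0 < x -> 0 < sinh x.
Proof. intros Hx. rewrite <- sinh_0. now apply sinh_lt. Qed.

Lemma beta_decreasing (d s t : R) : 0 < d -> 0 < s -> s <= t -> t < 2 * PI ->
  beta d t <= beta d s.
Proof.
  intros Hd Hs Hst Ht. assert (HP := PI_RGT_0).
  assert (H := beta_diff_ge d s t Hd Hs Hst Ht).
  assert (HPd : 0 < PI / (2 * d)) by (apply Rdiv_lt_0_compat; lra).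
  assert (H1 : 0 <= coth (PI / (2 * d) * s) - coth (PI / (2 * d) * t)).
  { rewrite coth_diff by nra. apply Rmult_le_pos.
    - assert (H2 : 0 <= PI / (2 * d) * t - PI / (2 * d) * s) by nra.
      destruct H2 as [H2|<-]; [left; now apply sinh_pos|right; now rewrite sinh_0].
    - left. apply Rinv_0_lt_compat, Rmult_lt_0_compat; apply sinh_pos; nra. }
  assert (0 <= (t - s) / d) by (apply Rmult_le_pos; [lra|]; left; apply Rinv_0_lt_compat; lra).
  assert (0 < PI / d) by (apply Rdiv_lt_0_compat; lra).
  nra.
Qed.

(** At [s = PI] the two Lambert series telescope. *)
Lemma beta_PI (d : R) : 0 < d -> beta d PI = 0.
Proof.
  intros Hd. assert (HP := PI_RGT_0).
  assert (Hr := nome_bounds d Hd).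
  rewrite beta_eq by lra. unfold beta_regular, lambert.
  (* Without its first term, the series at [exp (PI ^ 2 / d)] equals the one at
     [exp (- (PI ^ 2 / d))], the two arguments differing by the factor [r]. The first term is
     [coth (PI ^ 2 / (2 * d)) - 1], and the leftover [PI / d] cancels [- PI / d]. *)
  rewrite (Series_incr_1 (lambert_term _ (exp (PI / d * PI))))
    by (apply ex_series_lambert; [exact Hr|apply exp_pos|apply nome_mul_exp; lra]).
  rewrite (Series_ext
    (fun k => lambert_term (exp (- (2 * PI ^ 2 / d))) (exp (PI / d * PI)) (S k))
    (lambert_term (exp (- (2 * PI ^ 2 / d))) (exp (- (PI / d * PI))))).
  2:{ intros k. unfold lambert_term.
      replace (exp (- (2 * PI ^ 2 / d)) ^ S (S k) * exp (PI / d * PI))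
        with (exp (- (2 * PI ^ 2 / d)) ^ S k * exp (- (PI / d * PI))); [reflexivity|].
      change (exp (- (2 * PI ^ 2 / d)) ^ S (S k))
        with (exp (- (2 * PI ^ 2 / d)) * exp (- (2 * PI ^ 2 / d)) ^ S k).
      replace (exp (- (PI / d * PI)))
        with (exp (- (2 * PI ^ 2 / d)) * exp (PI / d * PI)); [ring|].
      rewrite <- exp_plus. f_equal. field. lra. }
  assert (Hc := coth_exp (PI / (2 * d) * PI)).
  rewrite Hc by (assert (0 < PI / (2 * d)) by (apply Rdiv_lt_0_compat; lra); nra).
  unfold lambert_term at 2. rewrite pow_1, <- exp_plus.
  replace (- (2 * PI ^ 2 / d) + PI / d * PI)
    with (- (2 * (PI / (2 * d) * PI))) by (field; lra).
  unfold Rdiv. ring.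
Qed.

Lemma beta_nonneg (d s : R) : 0 < d -> 0 < s <= PI -> 0 <= beta d s.
Proof.
  intros Hd Hs. assert (HP := PI_RGT_0).
  rewrite <- (beta_PI d Hd). apply beta_decreasing; lra.
Qed.

(** * The numerical bound for the kernel at a quarter period *)

Lemma PI_lt_16_5 : PI < 16 / 5.
Proof.
  (* The Leibniz series for [PI / 4], cut after the 21 terms with indices 0 to 20. *)
  destruct (PI_ineq 10) as [_ H]. unfold tg_alt, PI_tg in H. simpl in H. lra.
Qed.

(** Three ranges: above [6 / 5] the term [y] suffices; up to [9 / 10], [exp (- y) > 1 - y] bounds
    [sinh y] above; in between, [exp y <= 9] does. The constant [6 / 5] is large enough because
    [12 * PI ^ 2 < 104 * (6 / 5)]. *)
Lemma sinh_twice_bound (y : R) : 0 < y -> 6 / 5 < y + 2 * y / sinh y.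
Proof.
  intros Hy. assert (Hs := sinh_pos y Hy).
  assert (Hq : 0 < 2 * y / sinh y) by (apply Rdiv_lt_0_compat; lra).
  destruct (Rle_dec (6 / 5) y) as [H|H]; [lra|].
  assert (Hc : forall c, 0 < c -> sinh y <= c -> 2 * y / c <= 2 * y / sinh y).
  { intros c Hc1 Hc2. apply Rmult_le_compat_l; [lra|]. now apply Rinv_le_contravar. }
  destruct (Rle_dec y (9 / 10)) as [H1|H1].
  - assert (He : 1 - y < exp (- y)).
    { assert (K := exp_ineq1 (- y)). lra. }
    assert (Hs2 : sinh y <= (/ (1 - y) - (1 - y)) / 2).
    { unfold sinh.
      assert (exp y <= / (1 - y)); [|lra].
      rewrite <- (Ropp_involutive y) at 1. rewrite exp_Ropp.
      apply Rinv_le_contravar; lra. }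
    assert (K : 0 < (/ (1 - y) - (1 - y)) / 2) by lra.
    apply Hc in Hs2; [|exact K].
    replace (2 * y / ((/ (1 - y) - (1 - y)) / 2)) with (4 * (1 - y) / (2 - y)) in Hs2.
    2:{ field. repeat split; try lra. nra. }
    apply Rlt_le_trans with (y + 4 * (1 - y) / (2 - y)); [|lra].
    (* Multiplied out, this is [5 y ^ 2 + 4 y < 8], which holds up to [y = 9 / 10]. *)
    apply (Rmult_lt_reg_r (2 - y)); [lra|].
    replace ((y + 4 * (1 - y) / (2 - y)) * (2 - y)) with (y * (2 - y) + 4 * (1 - y))
      by (field; lra).
    nra.
  - assert (Hs2 : sinh y <= 9 / 2).
    { unfold sinh. assert (H2 := exp_pos (- y)).
      assert (exp y <= 9); [|lra].
      apply Rle_trans with (exp (1 + 1)); [left; apply exp_increasing; lra|].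
      rewrite exp_plus. assert (K := exp_le_3). assert (K1 := exp_pos 1). nra. }
    apply Hc in Hs2; lra.
Qed.

(** Apply [beta_diff_ge] between [PI / 2] and the zero [PI]. By [coth_diff] the factor
    [sinh (y / 2)] cancels, and [PI / d = 2 * y / PI]. *)
Lemma beta_half_pi (d : R) : 0 < d ->
  0 < beta d (PI / 2) /\ 12 * PI / beta d (PI / 2) < 104.
Proof.
  intros Hd. assert (HP := PI_RGT_0). assert (HP1 := PI_lt_16_5).
  assert (H := beta_diff_ge d (PI / 2) PI Hd). rewrite (beta_PI d Hd) in H.
  set (y := PI ^ 2 / (2 * d)).
  assert (Hy : 0 < y) by (apply Rdiv_lt_0_compat; nra).
  rewrite coth_diff in H.
  2,3: assert (0 < PI / (2 * d)) by (apply Rdiv_lt_0_compat; lra); nra.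
  replace (PI / (2 * d) * PI) with y in H by (unfold y; field; lra).
  replace (PI / (2 * d) * (PI / 2)) with (y / 2) in H by (unfold y; field; lra).
  replace (y - y / 2) with (y / 2) in H by field.
  assert (Hs1 := sinh_pos (y / 2) ltac:(lra)). assert (Hs2 := sinh_pos y Hy).
  replace (PI / d * (sinh (y / 2) / (sinh (y / 2) * sinh y)) + (PI - PI / 2) / d)
    with ((y + 2 * y / sinh y) / PI) in H.
  2:{ unfold y at 1 2. field. repeat split; lra. }
  assert (Hb := sinh_twice_bound y Hy).
  assert (Hlow : 6 / 5 / PI < beta d (PI / 2)).
  { apply Rlt_le_trans with ((y + 2 * y / sinh y) / PI); [|lra].
    apply Rmult_lt_compat_r; [now apply Rinv_0_lt_compat|lra]. }
  assert (Hlow2 : 6 / 5 < beta d (PI / 2) * PI).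
  { apply (Rmult_lt_compat_r PI) in Hlow; [|lra].
    replace (6 / 5 / PI * PI) with (6 / 5) in Hlow by (field; lra). lra. }
  assert (Hpos : 0 < beta d (PI / 2)) by nra.
  split; [exact Hpos|].
  apply (Rmult_lt_reg_r (beta d (PI / 2))); [lra|].
  replace (12 * PI / beta d (PI / 2) * beta d (PI / 2)) with (12 * PI) by (field; lra).
  apply (Rmult_lt_reg_r PI); [lra|]. nra.
Qed.

(** * The Hilbert transform of an odd function *)

(** With [l] the derivative of [f] at [x], the value at [t = 0] fills the removable singularity. *)
Definition slope (f : R -> R) (x l t : R) : R :=
  if Req_EM_T t 0 then l else (f (x + t) - f x) / t.

Lemma continuous_slope (f : R -> R) (x l t : R) :
  (forall y, continuous f y) -> is_derive f x l -> continuous (slope f x l) t.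
Proof.
  intros Hf Hl. destruct (Req_dec t 0) as [->|Ht].
  - apply is_derive_Reals in Hl. apply continuity_pt_filterlim. intros eps Heps.
    destruct (Hl eps Heps) as [delta Hdelta].
    exists delta. split; [apply cond_pos|].
    intros y [_ Hy]. simpl in *. unfold R_dist in *. rewrite Rminus_0_r in Hy.
    unfold slope. destruct (Req_EM_T 0 0) as [_|E]; [|now contradiction E].
    destruct (Req_EM_T y 0) as [_|E].
    + rewrite Rminus_diag, Rabs_R0. exact Heps.
    + now apply Hdelta.
  - apply continuous_ext_loc with (fun t => (f (x + t) - f x) * / t).
    + exists (mkposreal (Rabs t) (Rabs_pos_lt t Ht)). intros y Hy.
      unfold slope. destruct (Req_EM_T y 0) as [->|_]; [|reflexivity].
      exfalso. unfold ball in Hy; simpl in Hy.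
      unfold AbsRing_ball, abs, minus, plus, opp in Hy; simpl in Hy.
      rewrite Rplus_0_l, Rabs_Ropp in Hy. lra.
    + apply (continuous_mult (K := R_AbsRing)).
      * apply (continuous_minus (V := R_NormedModule)); [|apply continuous_const].
        apply (continuous_comp (fun t => x + t) f); [|apply Hf].
        apply (continuous_plus (V := R_NormedModule)); [apply continuous_const|apply continuous_id].
      * apply (ex_derive_continuous (V := R_NormedModule)). auto_derive. exact Ht.
Qed.

(** The pole of [beta d] at [0] is simple, so a zero of [F] cancels it. *)
Lemma beta_mult_extension (d : R) (F : R -> R) (x : R) :
  0 < d -> (forall y, continuous F y) -> ex_derive F x -> F x = 0 ->
  exists f : R -> R,
    (forall t, - (2 * PI) < t < 2 * PI -> continuous f t) /\
    (forall t, t <> 0 -> - (2 * PI) < t < 2 * PI -> f t = beta d t * F (x + t)).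
Proof.
  intros Hd HF [l Hl] H0. assert (HP := PI_RGT_0).
  set (k := PI / (2 * d)).
  assert (Hk : 0 < k) by (apply Rdiv_lt_0_compat; lra).
  set (S := fun t => sinh (k * t)).
  assert (HS : is_derive S 0 k).
  { unfold S, sinh. auto_derive; [exact I|]. rewrite Rmult_0_r, Ropp_0, exp_0. field. }
  assert (HSc : forall y, continuous S y).
  { intros y. apply (ex_derive_continuous (V := R_NormedModule)).
    unfold S, sinh. auto_derive. exact I. }
  assert (HSn : forall t, t <> 0 -> S t <> 0).
  { intros t Ht. unfold S. rewrite <- sinh_0.
    destruct (Rdichotomy t 0 Ht) as [H|H].
    - apply Rlt_not_eq, sinh_lt. nra.
    - apply Rgt_not_eq, sinh_lt. nra. }
  assert (HS0 : S 0 = 0) by (unfold S; rewrite Rmult_0_r; apply sinh_0).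
  assert (Hsn : forall t, slope S 0 k t <> 0).
  { intros t. unfold slope. destruct (Req_EM_T t 0) as [E|E]; [lra|].
    rewrite Rplus_0_l, HS0, Rminus_0_r.
    apply Rmult_integral_contrapositive_currified; [now apply HSn|now apply Rinv_neq_0_compat]. }
  assert (HFt : forall t, continuous (fun t => F (x + t)) t).
  { intros t. apply (continuous_comp (fun t => x + t) F); [|apply HF].
    apply (continuous_plus (V := R_NormedModule)); [apply continuous_const|apply continuous_id]. }
  (* In [coth (k * t) * F (x + t)], numerator and denominator are both divided by [t]; the quotient
     of [S] vanishes nowhere, its value at [0] being [k]. *)
  exists (fun t => PI / d * (cosh (k * t) * (slope F x l t * / slope S 0 k t))
                   + beta_regular d t * F (x + t)).
  split.
  - intros t Ht. apply (continuous_plus (V := R_NormedModule)).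
    + apply (continuous_scal_r (V := R_NormedModule)).
      apply (continuous_mult (K := R_AbsRing)).
      * apply (ex_derive_continuous (V := R_NormedModule)). unfold cosh. auto_derive. exact I.
      * apply (continuous_mult (K := R_AbsRing)); [now apply continuous_slope|].
        apply continuous_comp; [now apply continuous_slope|].
        apply (ex_derive_continuous (V := R_NormedModule)). auto_derive. apply Hsn.
    + apply (continuous_mult (K := R_AbsRing)); [now apply continuous_beta_regular|apply HFt].
  - intros t Ht Ht2. rewrite beta_eq by lra.
    unfold slope. destruct (Req_EM_T t 0) as [E|_]; [contradiction|].
    rewrite H0, HS0, Rplus_0_l. unfold coth. fold k. change (sinh (k * t)) with (S t).
    field. repeat split; try lra. now apply HSn.
Qed.

(** * The principal value as an ordinary integral *)

Lemma locally'_0_Rabs_lt (c : R) : 0 < c ->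
  Rbar_locally' 0 (fun e => 0 < Rabs e < c).
Proof.
  intros Hc. exists (mkposreal c Hc). intros e He Hne.
  unfold ball in He; simpl in He. unfold AbsRing_ball, abs, minus, plus, opp in He; simpl in He.
  rewrite Ropp_0, Rplus_0_r in He. split; [now apply Rabs_pos_lt|exact He].
Qed.

(** The integral is continuous in its lower endpoint. Continuity of [f] on both sides of [0] makes
    that endpoint interior, and [Rabs] is then composed with it. *)
Lemma is_lim_RInt_Rabs (f : R -> R) (c : R) : 0 < c ->
  (forall t, - c <= t <= c -> continuous f t) ->
  is_lim (fun e => RInt f (Rabs e) c) 0 (RInt f 0 c).
Proof.
  intros Hc Hf.
  assert (Hex : forall a, - c <= a <= c -> ex_RInt f a c).
  { intros a Ha. apply (ex_RInt_continuous (V := R_CompleteNormedModule)).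
    intros z. rewrite Rmin_left, Rmax_right by lra. intros Hz. apply Hf. lra. }
  assert (Hcont : continuous (fun a => RInt f a c) 0).
  { apply (continuous_RInt_2 f 0 c). exists (mkposreal c Hc). intros z Hz.
    apply (RInt_correct (V := R_CompleteNormedModule)), Hex.
    unfold ball in Hz; simpl in Hz. unfold AbsRing_ball, abs, minus, plus, opp in Hz; simpl in Hz.
    rewrite Ropp_0, Rplus_0_r in Hz. apply Rabs_def2 in Hz. lra. }
  rewrite <- Rabs_R0 at 2.
  apply (is_lim_continuity (fun e => RInt f (Rabs e) c) 0).
  apply (continuity_pt_comp Rabs (fun a => RInt f a c)).
  - apply Rcontinuity_abs.
  - rewrite Rabs_R0. now apply continuity_pt_filterlim.
Qed.

Lemma ex_RInt_continuous_within (f : R -> R) (r a b : R) :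
  (forall t, - r < t < r -> continuous f t) -> - r < a < r -> - r < b < r ->
  ex_RInt f a b.
Proof.
  intros Hf Ha Hb. apply (ex_RInt_continuous (V := R_CompleteNormedModule)).
  intros z Hz. apply Hf. split.
  - eapply Rlt_le_trans; [|apply Hz]. now apply Rmin_glb_lt.
  - eapply Rle_lt_trans; [apply Hz|]. now apply Rmax_lub_lt.
Qed.

(** [beta] is odd and [F] is odd about [x], so each half of the truncated integral is minus the
    integral of [beta d t * F (x + t)] over [(Rabs e, PI)]. As [F x = 0], the integrand extends
    continuously through [t = 0] and the limit is an ordinary integral. *)
Lemma hilbert_odd (d : R) (F : R -> R) (x : R) :
  0 < d -> (forall y, continuous F y) -> ex_derive F x ->
  (forall t, F (x - t) = - F (x + t)) ->
  ex_RInt (fun t => beta d t * F (x + t)) 0 PI /\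
  hilbert d F x = - / PI * RInt (fun t => beta d t * F (x + t)) 0 PI.
Proof.
  intros Hd HF HF' Hodd. assert (HP := PI_RGT_0).
  assert (H0 : F x = 0).
  { specialize (Hodd 0). rewrite Rminus_0_r, Rplus_0_r in Hodd. lra. }
  destruct (beta_mult_extension d F x Hd HF HF' H0) as [f [Hfc Hf]].
  assert (Hex : forall a b, - (2 * PI) < a < 2 * PI -> - (2 * PI) < b < 2 * PI -> ex_RInt f a b).
  { intros a b. now apply ex_RInt_continuous_within. }
  assert (Heq : forall t, Rmin 0 PI < t < Rmax 0 PI -> f t = beta d t * F (x + t)).
  { intros t. rewrite Rmin_left, Rmax_right by lra. intros Ht. apply Hf; lra. }
  split; [apply ex_RInt_ext with f; [exact Heq|apply Hex; lra]|].
  rewrite <- (RInt_ext f) by exact Heq.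
  unfold hilbert.
  assert (Hlim : is_lim (fun e =>
          RInt (fun s => beta d (x - s) * F s) (x - PI) (x - Rabs e) +
          RInt (fun s => beta d (x - s) * F s) (x + Rabs e) (x + PI)) 0
          (-2 * RInt f 0 PI)).
  { apply is_lim_ext_loc with (fun e => -2 * RInt f (Rabs e) PI).
    2:{ apply (is_lim_scal_l (fun e => RInt f (Rabs e) PI) (-2) 0 (RInt f 0 PI)).
        apply is_lim_RInt_Rabs; [exact HP|]. intros t Ht. apply Hfc. lra. }
    apply filter_imp with (2 := locally'_0_Rabs_lt PI HP).
    intros e He. set (c := Rabs e) in *.
    assert (Hbeta : forall t, c < t < PI -> beta d (- t) = - beta d t)
      by (intros t Ht; apply beta_opp; lra).
    assert (Hright : is_RInt (fun s => beta d (x - s) * F s) (x + c) (x + PI)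
                       (- RInt f c PI)).
    { apply is_RInt_ext with (fun s => - f (1 * s + - x)).
      { intros s. rewrite Rmin_left, Rmax_right by lra. intros Hs.
        replace (x - s) with (- (s - x)) by ring. rewrite Hbeta by lra.
        rewrite Rmult_1_l. change (s + - x) with (s - x). rewrite Hf by lra.
        replace (x + (s - x)) with s by ring. apply Ropp_mult_distr_l. }
      apply (is_RInt_opp (fun s => f (1 * s + - x))).
      apply is_RInt_ext with (fun s => scal 1 (f (1 * s + - x))).
      { intros s _. apply (scal_one (K := R_AbsRing)). }
      apply (is_RInt_comp_lin f 1 (- x)).
      replace (1 * (x + c) + - x) with c by ring.
      replace (1 * (x + PI) + - x) with PI by ring.
      apply (RInt_correct (V := R_CompleteNormedModule)), Hex; lra. }
    assert (Hleft : is_RInt (fun s => beta d (x - s) * F s) (x - PI) (x - c)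
                       (- RInt f c PI)).
    { apply is_RInt_ext with (fun s => scal (-1) (f (-1 * s + x))).
      { intros s. rewrite Rmin_left, Rmax_right by lra. intros Hs.
        replace (-1 * s + x) with (x - s) by ring. rewrite Hf by lra.
        replace s with (x - (x - s)) at 4 by ring. rewrite Hodd.
        change (-1 * (beta d (x - s) * F (x + (x - s)))
                = beta d (x - s) * - F (x + (x - s))). ring. }
      apply (is_RInt_comp_lin f (-1) x).
      replace (-1 * (x - PI) + x) with PI by ring.
      replace (-1 * (x - c) + x) with c by ring.
      apply (is_RInt_swap (V := R_NormedModule)).
      apply (RInt_correct (V := R_CompleteNormedModule)), Hex; lra. }
    rewrite (is_RInt_unique _ _ _ _ Hright), (is_RInt_unique _ _ _ _ Hleft). ring. }
  rewrite (is_lim_unique _ _ _ Hlim). simpl. field. lra.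
Qed.

(** * The amplitude bound *)

Lemma is_derive_nonneg_le (f f' : R -> R) (a b : R) :
  (forall x, is_derive f x (f' x)) -> (forall x, a < x < b -> 0 <= f' x) ->
  a <= b -> f a <= f b.
Proof.
  intros Hf Hf' [Hab| ->]; [|lra].
  destruct (MVT_cor2 f f' a b Hab) as [c [Hc1 Hc2]].
  - intros c _. now apply is_derive_Reals.
  - specialize (Hf' c Hc2). nra.
Qed.

Lemma RInt_beta_ge (d : R) (f : R -> R) :
  0 < d -> (forall t, continuous f t) -> (forall t, 0 < t < PI -> 0 <= f t) ->
  ex_RInt (fun t => beta d t * f t) 0 PI ->
  beta d (PI / 2) * RInt f 0 (PI / 2) <= RInt (fun t => beta d t * f t) 0 PI.
Proof.
  intros Hd Hc Hf Hex. assert (HP := PI_RGT_0).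
  assert (Hex1 : ex_RInt (fun t => beta d t * f t) 0 (PI / 2))
    by (apply (ex_RInt_Chasles_1 (V := R_CompleteNormedModule)) with PI; [lra|exact Hex]).
  assert (Hex2 : ex_RInt (fun t => beta d t * f t) (PI / 2) PI)
    by (apply (ex_RInt_Chasles_2 (V := R_CompleteNormedModule)) with 0; [lra|exact Hex]).
  assert (Hfi : ex_RInt f 0 (PI / 2))
    by (apply (ex_RInt_continuous (V := R_CompleteNormedModule)); intros; apply Hc).
  rewrite <- (RInt_Chasles _ _ _ _ Hex1 Hex2).
  assert (H1 : RInt (fun t => beta d (PI / 2) * f t) 0 (PI / 2)
               <= RInt (fun t => beta d t * f t) 0 (PI / 2)).
  { apply RInt_le; [lra| |exact Hex1|].
    - now apply (ex_RInt_scal (V := R_NormedModule) f).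
    - intros t Ht. apply Rmult_le_compat_r; [apply Hf; lra|].
      apply beta_decreasing; lra. }
  assert (H2 : 0 <= RInt (fun t => beta d t * f t) (PI / 2) PI).
  { apply RInt_ge_0; [lra|exact Hex2|]. intros t Ht.
    apply Rmult_le_pos; [apply beta_nonneg; lra|apply Hf; lra]. }
  rewrite <- (RInt_scal (V := R_CompleteNormedModule) f) by exact Hfi.
  change (RInt (fun t => beta d (PI / 2) * f t) 0 (PI / 2)
          <= RInt (fun t => beta d t * f t) 0 (PI / 2)
             + RInt (fun t => beta d t * f t) (PI / 2) PI).
  lra.
Qed.

(** The function weighted by [beta] is the derivative of [c0 u + c1 u ^ 2 / 2 - c2 u ^ 3 / 3]. The
    coefficients stay free because [c0] and the sign of [c1] differ between crest and trough. *)
Lemma RInt_beta_quadratic_ge (d c0 c1 c2 : R) (u u' : R -> R) :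
  0 < d -> (forall t, is_derive u t (u' t)) -> (forall t, continuous u' t) -> u 0 = 0 ->
  (forall t, 0 < t < PI -> 0 <= u' t) ->
  (forall t, 0 < t < PI -> 0 <= c0 + c1 * u t - c2 * u t ^ 2) ->
  ex_RInt (fun t => beta d t * ((c0 + c1 * u t - c2 * u t ^ 2) * u' t)) 0 PI ->
  beta d (PI / 2) * (c0 * u (PI / 2) + c1 * u (PI / 2) ^ 2 / 2 - c2 * u (PI / 2) ^ 3 / 3)
  <= RInt (fun t => beta d t * ((c0 + c1 * u t - c2 * u t ^ 2) * u' t)) 0 PI.
Proof.
  intros Hd Hu Hu' H0 Hmon Hpos Hex.
  assert (Huc : forall t, continuous u t).
  { intros t. apply (ex_derive_continuous (V := R_NormedModule)). now exists (u' t). }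
  assert (Hc : forall t, continuous (fun t => (c0 + c1 * u t - c2 * u t ^ 2) * u' t) t).
  { intros t. apply (continuous_mult (K := R_AbsRing)); [|apply Hu'].
    apply (continuous_comp u (fun z => c0 + c1 * z - c2 * z ^ 2)); [apply Huc|].
    apply (ex_derive_continuous (V := R_NormedModule)). auto_derive. exact I. }
  assert (Hint : is_RInt (fun t => (c0 + c1 * u t - c2 * u t ^ 2) * u' t) 0 (PI / 2)
                   (c0 * u (PI / 2) + c1 * u (PI / 2) ^ 2 / 2 - c2 * u (PI / 2) ^ 3 / 3)).
  { replace (c0 * u (PI / 2) + c1 * u (PI / 2) ^ 2 / 2 - c2 * u (PI / 2) ^ 3 / 3)
      with (minus ((fun t => c0 * u t + c1 * u t ^ 2 / 2 - c2 * u t ^ 3 / 3) (PI / 2))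
                  ((fun t => c0 * u t + c1 * u t ^ 2 / 2 - c2 * u t ^ 3 / 3) 0)).
    2:{ unfold minus, plus, opp; simpl. rewrite H0. field. }
    apply (is_RInt_derive (V := R_CompleteNormedModule)
             (fun t => c0 * u t + c1 * u t ^ 2 / 2 - c2 * u t ^ 3 / 3));
      [|intros t _; apply Hc].
    intros t _. auto_derive.
    - repeat split; now exists (u' t).
    - change (Derive (fun x => u x) t) with (Derive u t).
      rewrite (is_derive_unique _ _ _ (Hu t)). field. }
  rewrite <- (is_RInt_unique _ _ _ _ Hint).
  apply (RInt_beta_ge d (fun t => (c0 + c1 * u t - c2 * u t ^ 2) * u' t));
    [exact Hd|exact Hc| |exact Hex].
  intros t Ht. apply Rmult_le_pos; auto.
Qed.

(** [P x + P s + 2 gamma^2 h(x) h(s) = 2 (Q - 2 g h(x)) - 2 g (h(s) - h(x))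
    - gamma^2 (h(s) - h(x))^2]. *)
Lemma quasilinear_lhs_symmetric (d g gamma Q : R) (h : R -> R) (x : R) :
  0 < d -> (forall y, ex_derive h y) -> (forall y, ex_derive (Derive h) y) ->
  (forall t, h (x - t) = h (x + t)) ->
  let P := fun z => Q - 2 * g * h z - gamma ^ 2 * h z ^ 2 in
  let J := fun t => beta d t *
    ((2 * (Q - 2 * g * h x) - 2 * g * (h (x + t) - h x) - gamma ^ 2 * (h (x + t) - h x) ^ 2)
     * Derive h (x + t)) in
  ex_RInt J 0 PI /\
  hilbert d (fun z => P z * Derive h z) x + P x * hilbert d (Derive h) x
  + 2 * gamma ^ 2 * h x * hilbert d (fun z => h z * Derive h z) x
  = - / PI * RInt J 0 PI.
Proof.
  intros Hd H1 H2 Hsym P J.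
  assert (Hc2 : forall y, continuous (Derive h) y)
    by (intros y; apply (ex_derive_continuous (V := R_NormedModule)), H2).
  assert (Hd' : forall t, Derive h (x - t) = - Derive h (x + t)).
  { intros t.
    assert (E : Derive (fun s => h (x - s)) t = Derive (fun s => h (x + s)) t)
      by (apply Derive_ext; exact Hsym).
    rewrite (Derive_comp h (fun s => x - s)) in E; [|apply H1|auto_derive; exact I].
    rewrite (Derive_comp h (fun s => x + s)) in E; [|apply H1|auto_derive; exact I].
    replace (Derive (fun s : R => x - s) t) with (-1) in E
      by (symmetry; apply is_derive_unique; auto_derive; [exact I|ring]).
    replace (Derive (fun s : R => x + s) t) with (1) in E
      by (symmetry; apply is_derive_unique; auto_derive; [exact I|ring]).
    lra. }
  (* A factor even about [x] times [Derive h] is odd about [x]; this covers the transforms with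
     factor [P] and with factor [h]. *)
  assert (HG : forall G : R -> R, (forall y, ex_derive G y) ->
     (forall t, G (x - t) = G (x + t)) ->
     ex_RInt (fun t => beta d t * (G (x + t) * Derive h (x + t))) 0 PI /\
     hilbert d (fun z => G z * Derive h z) x
     = - / PI * RInt (fun t => beta d t * (G (x + t) * Derive h (x + t))) 0 PI).
  { intros G HG HGs. apply (hilbert_odd d (fun z => G z * Derive h z) x Hd).
    - intros y. apply (continuous_mult (K := R_AbsRing)); [|apply Hc2].
      apply (ex_derive_continuous (V := R_NormedModule)), HG.
    - apply (ex_derive_mult G (Derive h)); [apply HG|apply H2].
    - intros t. rewrite HGs, Hd'. ring. }
  destruct (HG P) as [E1 ->].
  { intros y. unfold P. auto_derive. repeat split; apply H1. }
  { intros t. unfold P. now rewrite Hsym. }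
  destruct (HG h H1 Hsym) as [E3 ->].
  destruct (hilbert_odd d (Derive h) x Hd Hc2 (H2 x) Hd') as [E2 ->].
  set (I1 := RInt _ 0 PI). set (I2 := RInt _ 0 PI). set (I3 := RInt _ 0 PI).
  assert (HJ : is_RInt J 0 PI (I1 + P x * I2 + 2 * gamma ^ 2 * h x * I3)).
  { apply is_RInt_ext with (fun t =>
      plus (plus (beta d t * (P (x + t) * Derive h (x + t)))
                 (scal (P x) (beta d t * Derive h (x + t))))
           (scal (2 * gamma ^ 2 * h x) (beta d t * (h (x + t) * Derive h (x + t))))).
    { intros t _.
      change (beta d t * (P (x + t) * Derive h (x + t))
              + P x * (beta d t * Derive h (x + t))
              + 2 * gamma ^ 2 * h x * (beta d t * (h (x + t) * Derive h (x + t))) = J t).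
      unfold P, J. ring. }
    apply (is_RInt_plus (V := R_NormedModule)); [apply (is_RInt_plus (V := R_NormedModule))|].
    - now apply (RInt_correct (V := R_CompleteNormedModule)).
    - apply (is_RInt_scal (V := R_NormedModule)).
      now apply (RInt_correct (V := R_CompleteNormedModule)).
    - apply (is_RInt_scal (V := R_NormedModule)).
      now apply (RInt_correct (V := R_CompleteNormedModule)). }
  split; [now eexists; exact HJ|].
  rewrite (is_RInt_unique _ _ _ _ HJ). ring.
Qed.

(** * Averages over a period *)

Lemma average_le (f : R -> R) (c : R) :
  (forall x, continuous f x) -> (forall x, - PI < x < PI -> f x <= c) -> average f <= c.
Proof.
  intros Hf Hc. assert (HP := PI_RGT_0). unfold average.
  assert (H : RInt f (- PI) PI <= RInt (fun _ => c) (- PI) PI).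
  { apply RInt_le; [lra| |apply ex_RInt_const|exact Hc].
    apply (ex_RInt_continuous (V := R_CompleteNormedModule)). intros; apply Hf. }
  rewrite RInt_const in H.
  change (RInt f (- PI) PI <= (PI - - PI) * c) in H.
  apply (Rmult_le_reg_r (2 * PI)); [lra|].
  unfold Rdiv. rewrite Rmult_assoc, Rinv_l by lra. lra.
Qed.

(** Integrate [2 a f - a ^ 2 <= f ^ 2], where [a] is the mean of [f]. *)
Lemma sqr_average_le (f : R -> R) :
  (forall x, continuous f x) -> average f ^ 2 <= average (fun x => f x ^ 2).
Proof.
  intros Hf. assert (HP := PI_RGT_0). set (a := average f).
  assert (Ha : 2 * PI * a = RInt f (- PI) PI) by (unfold a, average; field; lra).
  assert (Hex : ex_RInt f (- PI) PI)
    by (apply (ex_RInt_continuous (V := R_CompleteNormedModule)); intros; apply Hf).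
  assert (Hlin : is_RInt (fun x => minus (scal (2 * a) (f x)) (a ^ 2)) (- PI) PI
                   (2 * PI * a ^ 2)).
  { replace (2 * PI * a ^ 2)
      with (minus (scal (2 * a) (RInt f (- PI) PI)) (scal (PI - - PI) (a ^ 2))).
    - apply (is_RInt_minus (V := R_NormedModule)).
      + apply (is_RInt_scal (V := R_NormedModule)).
        now apply (RInt_correct (V := R_CompleteNormedModule)).
      + apply (is_RInt_const (V := R_NormedModule)).
    - change (2 * a * RInt f (- PI) PI - (PI - - PI) * a ^ 2 = 2 * PI * a ^ 2).
      rewrite <- Ha. ring. }
  assert (H : RInt (fun x => minus (scal (2 * a) (f x)) (a ^ 2)) (- PI) PI
              <= RInt (fun x => f x ^ 2) (- PI) PI).
  { apply RInt_le; [lra|now eexists; exact Hlin| |].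
    - apply (ex_RInt_continuous (V := R_CompleteNormedModule)). intros z _.
      apply (continuous_comp f (fun y => y ^ 2)); [apply Hf|].
      apply (ex_derive_continuous (V := R_NormedModule)). auto_derive. exact I.
    - intros x _. change (2 * a * f x - a ^ 2 <= f x ^ 2).
      assert (K := pow2_ge_0 (f x - a)). nra. }
  rewrite (is_RInt_unique _ _ _ _ Hlin) in H.
  unfold average. apply (Rmult_le_reg_r (2 * PI)); [lra|].
  unfold Rdiv. rewrite Rmult_assoc, Rinv_l by lra. lra.
Qed.

(** * The bound for a single wave *)

(** Here [G = gamma ^ 2], [H] is the crest height, [A] the amplitude, [p = Q - 2 g H],
    [mu = gamma |m| / d], [s] the mean of [eta ^ 2] and [c = beta d (PI / 2) / PI]; [u] and [v] are
    the drops of [eta] from [0] to [PI / 2] and from [PI / 2] to [PI]. *)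
Lemma amplitude_algebra (g d G H A p mu s c u v : R) :
  0 < g -> 0 < d -> 0 < G -> d <= H -> 0 <= A -> A < H -> 0 < p ->
  G * H ^ 2 < 2 * d * g -> mu < g -> d ^ 2 <= s ->
  0 <= u -> 0 <= v -> u + v = A -> 0 < c ->
  c * (2 * p * u + 2 * g * u ^ 2 / 2 - G * u ^ 3 / 3
       + ((2 * p + 4 * g * A) * v + - (2 * g) * v ^ 2 / 2 - G * v ^ 3 / 3))
  <= A * (2 * mu + 2 * g - G * s / d) + G * (H ^ 2 - (H - A) ^ 2) ->
  c * A < 12.
Proof.
  intros Hg Hd HG HdH HA HAH Hp HGH Hmu Hs Hu Hv Huv Hc Hmain.
  destruct (Rlt_le_dec (c * A) 12) as [K|K]; [exact K|exfalso].
  assert (HA0 : 0 < A) by nra.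
  assert (HGA2 : G * A < 2 * g).
  { assert (G * A * H <= G * H ^ 2) by (assert (0 < G * H) by nra; nra).
    assert (2 * d * g <= 2 * g * H) by nra.
    apply (Rmult_lt_reg_r H); lra. }
  assert (Hcub : u ^ 3 + v ^ 3 <= A ^ 3).
  { subst A. assert (0 <= u * v) by nra.
    replace ((u + v) ^ 3) with (u ^ 3 + v ^ 3 + 3 * (u * v) * (u + v)) by ring. nra. }
  (* Since [u = A - v], the terms without [p] and [G] add up to [g A ^ 2 + 2 g A v]; the terms in
     [p] are nonnegative. *)
  assert (HX : g * A ^ 2 - G * A ^ 3 / 3
    <= 2 * p * u + 2 * g * u ^ 2 / 2 - G * u ^ 3 / 3
       + ((2 * p + 4 * g * A) * v + - (2 * g) * v ^ 2 / 2 - G * v ^ 3 / 3)).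
  { assert (0 <= p * u) by nra. assert (0 <= p * v) by nra.
    assert (0 <= g * A * v) by (assert (0 <= g * A) by nra; nra).
    assert (G * (u ^ 3 + v ^ 3) <= G * A ^ 3) by nra.
    assert (g * u ^ 2 - g * v ^ 2 + 4 * g * A * v = g * A ^ 2 + 2 * (g * A * v))
      by (subst A; ring).
    lra. }
  assert (H1 : c * (g * A - G * A ^ 2 / 3) <= 2 * mu + 2 * g - G * s / d + G * (2 * H - A)).
  { apply (Rmult_le_reg_l A); [exact HA0|].
    apply (Rmult_le_compat_l c) in HX; [|lra].
    replace (A * (c * (g * A - G * A ^ 2 / 3)))
      with (c * (g * A ^ 2 - G * A ^ 3 / 3)) by field.
    replace (A * (2 * mu + 2 * g - G * s / d + G * (2 * H - A)))
      with (A * (2 * mu + 2 * g - G * s / d) + G * (H ^ 2 - (H - A) ^ 2)) by (field; lra).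
    lra. }
  assert (H2 : G * d <= G * s / d).
  { apply (Rmult_le_reg_r d); [exact Hd|].
    replace (G * s / d * d) with (G * s) by (field; lra). nra. }
  assert (H3 : 12 * (g - G * A / 3) <= c * A * (g - G * A / 3))
    by (apply Rmult_le_compat_r; lra).
  (* From the previous bounds, [12 g - 4 G A < 4 g - G d + G (2 H - A)]; then [A < H]. *)
  assert (H4 : 8 * g < G * (5 * H - d)).
  { assert (G * A <= G * H) by nra. nra. }
  assert (H5 : 8 * g * H ^ 2 < 2 * d * g * (5 * H - d)).
  { apply Rlt_trans with (G * (5 * H - d) * H ^ 2).
    - apply Rmult_lt_compat_r; [nra|exact H4].
    - replace (G * (5 * H - d) * H ^ 2) with (G * H ^ 2 * (5 * H - d)) by ring.
      apply Rmult_lt_compat_r; lra. }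
  (* Divided by [2 g], the preceding inequality reads [4 H ^ 2 - 5 d H + d ^ 2 < 0], whose left side
     factors as here. *)
  assert (H6 : 0 <= g * ((H - d) * (4 * H - d))).
  { apply Rmult_le_pos; [lra|]. apply Rmult_le_pos; lra. }
  nra.
Qed.

Lemma regular_wave_amplitude_lt (alpha g gamma d : R) (w : wave) :
  0 < g -> 0 < d -> 0 < gamma -> regular_wave alpha g gamma d w ->
  gamma * Rabs (mass_flux w) < g * d ->
  gamma ^ 2 * bernoulli w ^ 2 < 8 * d * g ^ 3 ->
  amplitude w < 12 * PI / beta d (PI / 2).
Proof.
  intros Hg Hd Hgam Hw HgamM HgamQ. assert (HP := PI_RGT_0).
  destruct (beta_half_pi d Hd) as [Hb _].
  destruct Hw as [Hsteady [Hconf [Hm [HQ [Hclass [Hper [Heven [Hav [_ [_ [Hstag Hmon]]]]]]]]]]].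
  destruct Hsteady as [_ [_ [Hpos _]]].
  destruct Hconf as [_ [Hquasi _]]. unfold quasilinear_equation in Hquasi.
  destruct Hclass as [Hd1 [Hd2 _]].
  unfold amplitude.
  set (h := eta w) in *. set (m := mass_flux w) in *. set (Q := bernoulli w) in *.
  (* A laminar wave has amplitude zero; the signs of [Derive h] are available only for the
     others. *)
  destruct (classic (laminar d w)) as [Hlam|Hnl].
  { assert (E : forall x, h x = d) by exact Hlam. rewrite !E, Rminus_diag.
    apply Rdiv_lt_0_compat; lra. }
  destruct (Hmon Hnl) as [Hneg Hpo].
  assert (Hder : forall x, is_derive h x (Derive h x)) by (intros x; apply Derive_correct, Hd1).
  assert (Hc : forall x, continuous h x)
    by (intros x; apply (ex_derive_continuous (V := R_NormedModule)), Hd1).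
  assert (Hc2 : forall x, continuous (Derive h) x)
    by (intros x; apply (ex_derive_continuous (V := R_NormedModule)), Hd2).
  assert (HperD : forall x, Derive h (x + 2 * PI) = Derive h x).
  { intros x. rewrite <- (Derive_ext (fun y => h (y + 2 * PI)) h x Hper).
    rewrite (Derive_comp h (fun y => y + 2 * PI)); [|apply Hd1|auto_derive; exact I].
    replace (Derive (fun y : R => y + 2 * PI) x) with 1
      by (symmetry; apply is_derive_unique; auto_derive; [exact I|ring]).
    ring. }
  assert (HtroughD : forall t, 0 < t < PI -> 0 < Derive h (PI + t)).
  { intros t Ht. replace (PI + t) with (t - PI + 2 * PI) by ring. rewrite HperD.
    apply Hpo. lra. }
  (* The drop from the crest and the rise from the trough: both increase from [0] to [A] on
     [[0, PI]]. The form [0 + t] matches [x + t] in [quasilinear_lhs_symmetric]. *)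
  set (u := fun t => h 0 - h (0 + t)). set (v := fun t => h (PI + t) - h PI).
  assert (Hu : forall t, is_derive u t (- Derive h (0 + t))).
  { intros t. unfold u. auto_derive; [apply Hd1|].
    change (Derive (fun x => h x)) with (Derive h). ring. }
  assert (Hv : forall t, is_derive v t (Derive h (PI + t))).
  { intros t. unfold v. auto_derive; [apply Hd1|].
    change (Derive (fun x => h x)) with (Derive h). ring. }
  assert (Hu0 : u 0 = 0) by (unfold u; rewrite Rplus_0_l; ring).
  assert (Hv0 : v 0 = 0) by (unfold v; rewrite Rplus_0_r; ring).
  assert (Hu' : forall t, 0 < t < PI -> 0 <= - Derive h (0 + t)).
  { intros t Ht. rewrite Rplus_0_l. specialize (Hneg t Ht). lra. }
  assert (Hv' : forall t, 0 < t < PI -> 0 <= Derive h (PI + t)).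
  { intros t Ht. specialize (HtroughD t Ht). lra. }
  set (A := h 0 - h PI).
  assert (Hsym : forall t, h (PI - t) = h (PI + t)).
  { intros t. rewrite <- (Heven (PI - t)), <- (Hper (- (PI - t))). f_equal. ring. }
  assert (HuPI : u PI = A) by (unfold u, A; now rewrite Rplus_0_l).
  assert (HvPI : v PI = A).
  { unfold v, A. rewrite <- Hsym, Rminus_diag. reflexivity. }
  assert (Hub : forall t, 0 <= t <= PI -> 0 <= u t <= A).
  { intros t Ht. rewrite <- Hu0, <- HuPI.
    split; (eapply is_derive_nonneg_le; [exact Hu| |lra]); intros x Hx; apply Hu'; lra. }
  assert (Hvb : forall t, 0 <= t <= PI -> 0 <= v t <= A).
  { intros t Ht. rewrite <- Hv0, <- HvPI.
    split; (eapply is_derive_nonneg_le; [exact Hv| |lra]); intros x Hx; apply Hv'; lra. }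
  assert (HA : 0 <= A) by (destruct (Hub 0); lra).
  set (H := h 0) in *.
  assert (HdH : d <= H).
  { rewrite <- Hav. apply average_le; [exact Hc|]. intros x Hx.
    assert (K : h x = h (Rabs x)).
    { unfold Rabs. destruct (Rcase_abs x); [now rewrite Heven|reflexivity]. }
    rewrite K. destruct (Hub (Rabs x)) as [K1 _].
    - split; [apply Rabs_pos|]. left. apply Rabs_def1; lra.
    - unfold u in K1. rewrite Rplus_0_l in K1. lra. }
  assert (HAH : A < H) by (unfold A; specialize (Hpos PI); fold h in Hpos; lra).
  assert (Hp : 0 < Q - 2 * g * H) by apply Hstag.
  (* Absence of stagnation at the crest gives [2 g H < Q]; divide the bound on [gamma ^ 2 * Q ^ 2]
     by [4 g ^ 2]. *)
  assert (HGH : gamma ^ 2 * H ^ 2 < 2 * d * g).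
  { assert (K : (2 * g * H) ^ 2 <= Q ^ 2) by (apply pow_incr; split; [nra|lra]).
    assert (K1 : gamma ^ 2 * (2 * g * H) ^ 2 <= gamma ^ 2 * Q ^ 2) by (apply Rmult_le_compat_l; nra).
    apply (Rmult_lt_reg_l (4 * g ^ 2)); [nra|]. lra. }
  assert (HGA : gamma ^ 2 * A <= 2 * g).
  { assert (K : gamma ^ 2 * A * H <= gamma ^ 2 * H ^ 2).
    { replace (gamma ^ 2 * H ^ 2) with (gamma ^ 2 * H * H) by ring.
      apply Rmult_le_compat_r; [lra|]. apply Rmult_le_compat_l; [nra|lra]. }
    assert (2 * d * g <= 2 * g * H) by nra.
    apply (Rmult_le_reg_r H); lra. }
  (* At the crest [2 g u] absorbs [gamma ^ 2 u ^ 2]. At the trough [2 g v + gamma ^ 2 v ^ 2 <= 4 g v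
     <= 4 g A], which is absorbed by [2 (Q - 2 g h(PI)) = 2 (Q - 2 g H) + 4 g A]. *)
  assert (Hsquare : forall z, 0 <= z <= A -> gamma ^ 2 * z ^ 2 <= 2 * g * z).
  { intros z Hz. assert (gamma ^ 2 * z <= 2 * g) by (assert (0 < gamma ^ 2) by nra; nra). nra. }
  destruct (quasilinear_lhs_symmetric d g gamma Q h 0 Hd Hd1 Hd2) as [Ex0 E0].
  { intros t. rewrite Rminus_0_l, Rplus_0_l. apply Heven. }
  destruct (quasilinear_lhs_symmetric d g gamma Q h PI Hd Hd1 Hd2 Hsym) as [Ex1 E1].
  rewrite Hquasi in E0, E1.
  (* [J0] is minus the crest integrand, since [u] reverses the sign of [Derive h]; [J1] keeps the
     sign. *)
  set (J0 := fun t => beta d t *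
    ((2 * (Q - 2 * g * H) + 2 * g * u t - gamma ^ 2 * u t ^ 2) * - Derive h (0 + t))).
  set (J1 := fun t => beta d t *
    ((2 * (Q - 2 * g * h PI) + - (2 * g) * v t - gamma ^ 2 * v t ^ 2) * Derive h (PI + t))).
  assert (HJ0 : is_RInt J0 0 PI (- RInt (fun t => beta d t *
    ((2 * (Q - 2 * g * h 0) - 2 * g * (h (0 + t) - h 0) - gamma ^ 2 * (h (0 + t) - h 0) ^ 2)
     * Derive h (0 + t))) 0 PI)).
  { eapply is_RInt_ext;
      [|apply (is_RInt_opp (V := R_NormedModule)),
         (RInt_correct (V := R_CompleteNormedModule)), Ex0].
    intros t _. unfold J0, u, H, opp; simpl. ring. }
  assert (HJ1 : is_RInt J1 0 PI (RInt (fun t => beta d t *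
    ((2 * (Q - 2 * g * h PI) - 2 * g * (h (PI + t) - h PI) - gamma ^ 2 * (h (PI + t) - h PI) ^ 2)
     * Derive h (PI + t))) 0 PI)).
  { eapply is_RInt_ext; [|apply (RInt_correct (V := R_CompleteNormedModule)), Ex1].
    intros t _. unfold J1, v; simpl. ring. }
  assert (Hshift : forall a t, continuous (fun s => Derive h (a + s)) t).
  { intros a t. apply (continuous_comp (fun s => a + s) (Derive h)); [|apply Hc2].
    apply (continuous_plus (V := R_NormedModule)); [apply continuous_const|apply continuous_id]. }
  assert (L0 := RInt_beta_quadratic_ge d (2 * (Q - 2 * g * H)) (2 * g) (gamma ^ 2)
    u (fun t => - Derive h (0 + t)) Hd Hu
    (fun t => continuous_opp (V := R_NormedModule) _ t (Hshift 0 t)) Hu0 Hu').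
  assert (L1 := RInt_beta_quadratic_ge d (2 * (Q - 2 * g * h PI)) (- (2 * g)) (gamma ^ 2)
    v (fun t => Derive h (PI + t)) Hd Hv (Hshift PI) Hv0 Hv').
  cbv beta in L0, L1. fold J0 in L0. fold J1 in L1.
  rewrite (is_RInt_unique _ _ _ _ HJ0) in L0. rewrite (is_RInt_unique _ _ _ _ HJ1) in L1.
  set (I0 := RInt _ 0 PI) in E0, L0. set (I1 := RInt _ 0 PI) in E1, L1.
  assert (HhPI : h PI = H - A) by (unfold A; ring).
  specialize (L0 ltac:(intros t Ht; assert (K := Hub t ltac:(lra)); assert (K1 := Hsquare _ K); lra)
    ltac:(eexists; exact HJ0)).
  specialize (L1 ltac:(intros t Ht; assert (K := Hvb t ltac:(lra)); assert (K1 := Hsquare _ K);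
      rewrite HhPI; nra) ltac:(eexists; exact HJ1)).
  assert (Hs : d ^ 2 <= average (fun z => h z ^ 2)) by (rewrite <- Hav at 1; now apply sqr_average_le).
  set (s := average (fun z => h z ^ 2)) in *.
  assert (Huv : u (PI / 2) + v (PI / 2) = A).
  { unfold u, v, A. rewrite <- Hsym, Rplus_0_l.
    replace (PI - PI / 2) with (PI / 2) by field. fold H. ring. }
  (* Crest minus trough: the terms of the right-hand side independent of [x] cancel. *)
  assert (Hdiff : / PI * (- I0 + I1)
    = A * (2 * (- m * gamma / d) + 2 * g - gamma ^ 2 * s / d)
      + gamma ^ 2 * (H ^ 2 - (H - A) ^ 2)).
  { rewrite HhPI in E1. fold H in E0. unfold Rdiv in *. lra. }
  apply (Rmult_lt_reg_r (beta d (PI / 2) / PI)); [now apply Rdiv_lt_0_compat|].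
  replace (12 * PI / beta d (PI / 2) * (beta d (PI / 2) / PI)) with 12 by (field; lra).
  rewrite Rmult_comm.
  apply (amplitude_algebra g d (gamma ^ 2) H A (Q - 2 * g * H) (- m * gamma / d) s
           (beta d (PI / 2) / PI) (u (PI / 2)) (v (PI / 2))); try assumption.
  - nra.
  - rewrite Rabs_left in HgamM by exact Hm.
    apply (Rmult_lt_reg_r d); [exact Hd|].
    replace (- m * gamma / d * d) with (gamma * - m) by (field; lra). lra.
  - apply Hub; lra.
  - apply Hvb; lra.
  - now apply Rdiv_lt_0_compat.
  - rewrite <- Hdiff. rewrite HhPI in L1.
    unfold Rdiv at 1. rewrite (Rmult_comm (beta d (PI / 2))), Rmult_assoc.
    apply Rmult_le_compat_l; [left; now apply Rinv_0_lt_compat|]. lra.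
Qed.

Theorem theorem1p3 (g d : R) (hg : 0 < g) (hd : 0 < d) :
  (forall Q0 m0 : R, 0 < Q0 -> 0 < m0 ->
   exists B : R, forall K : R, 0 < K ->
   exists gamma0 : R, 0 < gamma0 /\
   forall (gamma : R) (C : curve) (w : wave),
     0 < gamma < gamma0 ->
     bifurcation_curve g gamma d C ->
     belongs_to w C ->
     bernoulli w <= Q0 ->
     Rabs (mass_flux w) <= m0 ->
     max_slope w <= K \/ convexity w <= K ->
     amplitude w <= B)
  /\
  (forall (gamma : R) (C : curve) (w : wave),
     0 < gamma ->
     bifurcation_curve g gamma d C ->
     belongs_to w C ->
     let m := mass_flux w in
     let Q := bernoulli w in
     let N := max_slope w in
     let M := convexity w in
     let b := beta d (PI / 2) in
     gamma < g * d / Rabs m ->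
     gamma ^ 2 < 8 * d * g ^ 3 / Q ^ 2 ->
     (N * gamma ^ 2 < g * b / 8 /\
      gamma ^ 2 < 1 / (1 / 2 + 1 / d) * (g * b ^ 2 / (77 * PI ^ 2)))
     \/
     (sqrt M * gamma ^ 2 < PI * g / 4 * Rpower (b / (12 * PI)) (3 / 2) /\
      gamma ^ 2 < 2 * g / (1 / 2 + 1 / d) * (b / (12 * PI)) ^ 2) ->
     amplitude w < 12 * PI / b /\ 12 * PI / b < 104).
Proof.
  assert (Hg3 : 0 < 8 * d * g ^ 3) by (assert (0 < g ^ 3) by (now apply pow_lt); nra).
  split.
  - intros Q0 m0 HQ0 Hm0. exists (12 * PI / beta d (PI / 2)). intros K _.
    (* The constant is the one of part (b). [gamma < g * d / m0] ensures [gamma |m| < g d], and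
       [gamma < q] ensures [gamma ^ 2 Q ^ 2 < 8 d g ^ 3]. *)
    set (q := sqrt (8 * d * g ^ 3) / Q0).
    assert (Hq : 0 < q) by (apply Rdiv_lt_0_compat; [now apply sqrt_lt_R0|lra]).
    exists (Rmin (g * d / m0) q). split.
    { apply Rmin_pos; [apply Rdiv_lt_0_compat; nra|exact Hq]. }
    intros gamma C w Hgam HC Hw HQ Hm _.
    destruct HC as [_ [alpha [_ [_ [_ [Hreg _]]]]]]. specialize (Hreg w Hw).
    assert (HQpos : 0 < bernoulli w) by apply Hreg.
    assert (H1 : gamma * m0 < g * d).
    { replace (g * d) with (g * d / m0 * m0) by (field; lra).
      apply Rmult_lt_compat_r; [lra|].
      eapply Rlt_le_trans; [apply Hgam|apply Rmin_l]. }
    assert (H2 : gamma * Q0 < sqrt (8 * d * g ^ 3)).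
    { replace (sqrt (8 * d * g ^ 3)) with (q * Q0) by (unfold q; field; lra).
      apply Rmult_lt_compat_r; [lra|].
      eapply Rlt_le_trans; [apply Hgam|apply Rmin_r]. }
    left. apply (regular_wave_amplitude_lt alpha g gamma d w); try assumption; try lra.
    + nra.
    + rewrite <- (sqrt_sqrt (8 * d * g ^ 3)) by lra.
      assert (H3 : gamma * bernoulli w < sqrt (8 * d * g ^ 3)) by nra.
      assert (0 < gamma * bernoulli w) by nra. nra.
  - intros gamma C w Hgam HC Hw m Q N M b H1 H2 _.
    destruct HC as [_ [alpha [_ [_ [_ [Hreg _]]]]]]. specialize (Hreg w Hw).
    assert (HQ : 0 < Q) by apply Hreg. assert (Hm : m < 0) by apply Hreg.
    split; [|now apply beta_half_pi].
    apply (regular_wave_amplitude_lt alpha g gamma d w); try assumption.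
    + fold m. assert (HM : 0 < Rabs m) by (apply Rabs_pos_lt; lra).
      replace (g * d) with (g * d / Rabs m * Rabs m) by (field; lra).
      apply Rmult_lt_compat_r; lra.
    + fold Q. replace (8 * d * g ^ 3) with (8 * d * g ^ 3 / Q ^ 2 * Q ^ 2) by (field; lra).
      apply Rmult_lt_compat_r; [nra|exact H2].
Qed.
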